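(* Let $\mathcal{C}$ be a finite family of subsets of $[d]$, and let $\mathbb{P}_0$ and $\mathbb{P}_{\mathcal{S}}$ ($\mathcal{S}\in\mathcal{C}$) be probability distributions of a random vector $\boldsymbol{X}$ with domain $\mathcal{X}$. Assume: (1) for $\mathcal{S}'$ drawn uniformly at random from $\mathcal{C}$ and $\mathcal{S}\in\mathcal{C}$ fixed, the distribution of $|\mathcal{S}\cap\mathcal{S}'|$ is the same for all $\mathcal{S}$; (2) for any $\mathcal{S}_1,\mathcal{S}_2\in\mathcal{C}$, $$\mathbb{E}_{\mathbb{P}_0}\left[\frac{\mathrm{d}\mathbb{P}_{\mathcal{S}_1}}{\mathrm{d}\mathbb{P}_0}\frac{\mathrm{d}\mathbb{P}_{\mathcal{S}_2}}{\mathrm{d}\mathbb{P}_0}(\boldsymbol{X})\right]=h(|\mathcal{S}_1\cap\mathcal{S}_2|),$$ where $h$ is a nondecreasing function with $h(0)\ge 1$. Then, for any query function $q$, $$\sup_{\mathcal{S}\in\mathcal{C}(q)}\left\{\mathbb{E}_{\mathcal{S}'\sim\mathbb{Q}_{\overline{\mathcal{C}}(q,\mathcal{S})}}[h(|\mathcal{S}\cap\mathcal{S}'|)]\right\}\ge 1+\frac{\log(1/\xi)}{n}.$$ Here the left-hand side only depends on $|\mathcal{C}(q)|$, and is a nonincreasing function of $|\mathcal{C}(q)|$.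
   Context: Parameters: $b>0$, sample size $n$, and $\xi\in[0,1/4)$. A query function is a function $q:\mathcal{X}\to[-b,b]$. The set $\mathcal{C}(q)=\{\mathcal{S}\in\mathcal{C}: |\mathbb{E}_{\mathbb{P}_{\mathcal{S}}}[q(\boldsymbol{X})]-\mathbb{E}_{\mathbb{P}_0}[q(\boldsymbol{X})]|>\overline{\tau}_q\}$, where $\overline{\tau}_q=\max\{\frac{2b}{3}\cdot\frac{\log(1/\xi)}{n},\sqrt{2\,\mathrm{Var}_{\mathbb{P}_0}[q(\boldsymbol{X})]\cdot\log(1/\xi)/n}\}$. For $\overline{\mathcal{C}}\subseteq\mathcal{C}$, $\mathbb{Q}_{\overline{\mathcal{C}}}$ is the uniform distribution over $\overline{\mathcal{C}}$. For $\mathcal{S}\in\mathcal{C}(q)$, $\overline{\mathcal{C}}(q,\mathcal{S})\subseteq\mathcal{C}$ is a maximizer of $\mathbb{E}_{\mathcal{S}'\sim\mathbb{Q}_{\overline{\mathcal{C}}}}[h(|\mathcal{S}\cap\mathcal{S}'|)]$ over subsets $\overline{\mathcal{C}}\subseteq\mathcal{C}$ with $|\overline{\mathcal{C}}|=|\mathcal{C}(q)|$ (not necessarily unique; the result holds for any choice). *)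

(* Defs.v *)
From HB Require Import structures.
From mathcomp Require Import all_boot all_order all_algebra.
From mathcomp Require Import all_classical all_reals all_analysis.

Set Implicit Arguments.
Unset Strict Implicit.
Unset Printing Implicit Defensive.

Import Order.TTheory GRing.Theory Num.Theory.
Local Open Scope ring_scope.
Local Open Scope ereal_scope.
Local Open Scope charge_scope.

(* Expectation of [f] under the uniform distribution over the finite family
   [A] (meaningful for [A] nonempty). *)
Definition unif_mean (R : realType) (T : finType) (A : {set T}) (f : T -> R)
    : R :=
  ((\sum_(x in A) f x) / #|A|%:R)%R.

(* Probability that |S :&: S'| = k when S' is uniform over [C]. *)
Definition overlap_pmf (R : realType) (d : nat) (C : {set {set 'I_d}})
    (S : {set 'I_d}) (k : nat) : R :=
  unif_mean C (fun S' => (#|S :&: S'| == k)%:R%R).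

(* Radon-Nikodym derivative dP/dP0; a junk value unless P `<< P0. *)
Definition likelihood_ratio (R : realType) (disp : measure_display)
    (X : measurableType disp) (P P0 : probability X R) : X -> \bar R :=
  'd (charge_of_finite_measure P) '/d P0.

Definition query_function (R : realType) (disp : measure_display)
    (X : measurableType disp) (b : R) (q : X -> R) : Prop :=
  measurable_fun [set: X] q /\ forall x, (- b <= q x <= b)%R.

(* Extended-real valued, so that log (1 / xi) = +oo when xi = 0. *)
Definition log_inv (R : realType) (xi : R) : \bar R := lne (xi%:E^-1).

Definition tau_bar (R : realType) (disp : measure_display)
    (X : measurableType disp) (P0 : probability X R) (b : R) (n : nat) (xi : R)
    (q : X -> R) : \bar R :=
  Order.max ((2 * b / 3)%:E * (log_inv xi / n%:R%:E))
            (sqrte (2%:E * 'V_P0[q] * log_inv xi / n%:R%:E)).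

(* The family C(q). *)
Definition distinguished (R : realType) (disp : measure_display)
    (X : measurableType disp) (d : nat) (C : {set {set 'I_d}})
    (P0 : probability X R) (P : {set 'I_d} -> probability X R)
    (b : R) (n : nat) (xi : R) (q : X -> R) : {set {set 'I_d}} :=
  [set S in C | tau_bar P0 b n xi q < `| 'E_(P S)[q] - 'E_P0[q] |]%SET.

Definition mean_overlap (R : realType) (d : nat) (h : nat -> R)
    (A : {set {set 'I_d}}) (S : {set 'I_d}) : R :=
  unif_mean A (fun S' => h #|S :&: S'|).

(* [A] is an admissible choice of the maximizing subfamily, with [m] standing
   for |C(q)|. *)
Definition is_max_subfamily (R : realType) (d : nat) (h : nat -> R)
    (C : {set {set 'I_d}}) (m : nat) (S : {set 'I_d}) (A : {set {set 'I_d}})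
    : Prop :=
  [/\ A \subset C, #|A| = m &
    forall B : {set {set 'I_d}}, B \subset C -> #|B| = m ->
      (mean_overlap h B S <= mean_overlap h A S)%R].

Definition sup_mean_overlap (R : realType) (d : nat) (h : nat -> R)
    (D : {set {set 'I_d}}) (Cbar : {set 'I_d} -> {set {set 'I_d}}) : \bar R :=
  ereal_sup [set (mean_overlap h (Cbar S) S)%:E | S in [set` D]].

(* Main.v *)
Require Import Defs.
From HB Require Import structures.
From mathcomp Require Import all_boot all_order all_algebra.
From mathcomp Require Import all_classical all_reals all_analysis.
From mathcomp Require Import measurable_realfun ring lra.

Set Implicit Arguments.
Unset Strict Implicit.
Unset Printing Implicit Defensive.

Import Order.TTheory GRing.Theory Num.Theory.
Local Open Scope ring_scope.
Local Open Scope ereal_scope.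

(* Let g_S be the density of P_S with respect to P_0. Under P_0 the g_S have
   mean 1 and covariances h(|S :&: S'|) - 1 >= 0, and the covariance of g_S and
   q is c_S = E_S[q] - E_0[q]. Pairing q with the sum of sgn(c_S) g_S over
   S in C(q), Cauchy-Schwarz gives
     (sum_S |c_S|)^2 <= Var_0[q] * sum_{S,S'} (h(|S :&: S'|) - 1).
   On C(q) each |c_S| exceeds sqrt(2 Var_0[q] log(1/xi) / n), so some S in C(q)
   has mean overlap at least 1 + log(1/xi) / n over C(q), hence also over the
   maximizing subfamily. When xi = 0 the threshold is +oo and C(q) is empty.

   For the second part, equality of the overlap distributions lets any
   subfamily be exchanged for another of the same size with the same mean
   overlap at another S, so the supremum is the maximum over all S in C and
   all subfamilies of size |C(q)|. It is nonincreasing because discarding an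
   element of least overlap does not decrease the mean. *)

(** * Covariances of square-integrable functions *)

Section covariance.
Context (disp : measure_display) (T : measurableType disp) (R : realType).
Context (P : probability T R).
Implicit Types (f g : T -> R).

Lemma Lfun2_of_sqr f : measurable_fun [set: T] f ->
  \int[P]_x ((f x) ^+ 2)%:E < +oo -> f \in Lfun P 2%:E.
Proof.
move=> mf f2; rewrite inE; apply/andP; split; rewrite inE//=.
rewrite /finite_norm unlock /Lnorm poweR_lty//.
by under eq_integral => x _ do
  rewrite /= (powR_mulrn 2) ?normr_ge0// real_normK ?num_real//.
Qed.

Lemma Lfun2_bounded f (b : R) : measurable_fun [set: T] f ->
  (forall x, `|f x| <= b)%R -> f \in Lfun P 2%:E.
Proof.
move=> mf fb; apply: Lfun2_of_sqr => //.
apply: (@le_lt_trans _ _ (\int[P]_x (b ^+ 2)%:E)).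
  apply: ge0_le_integral => //.
  - by move=> x _; rewrite lee_fin sqr_ge0.
  - by apply/measurable_EFinP; exact: measurable_funX.
  - by move=> x _; rewrite lee_fin -real_normK ?num_real// lerXn2r ?nnegrE//
      (le_trans _ (fb x)).
by rewrite integral_cst//= probability_setT mule1 ltry.
Qed.

Lemma Lfun2_Lfun1 f : f \in Lfun P 2%:E -> f \in Lfun P 1.
Proof. by apply: Lfun_subset12; rewrite fin_num_measure. Qed.

Lemma fin_num_covariance f g : f \in Lfun P 2%:E -> g \in Lfun P 2%:E ->
  covariance P f g \is a fin_num.
Proof.
by move=> f2 g2; rewrite covariance_fin_num ?Lfun2_mul_Lfun1 ?Lfun2_Lfun1.
Qed.

(** Square-integrability and the formula are proved together because additivity of the covariance,
    at each step of the induction, needs the partial sums to be square-integrable. *)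
Lemma covariance_suml (I : Type) (r : seq I) (A : pred I) (a : I -> R)
    (F : I -> T -> R) g :
  (forall i, A i -> F i \in Lfun P 2%:E) -> g \in Lfun P 2%:E ->
  (\sum_(i <- r | A i) a i \o* F i)%R \in Lfun P 2%:E /\
  (fine (covariance P (\sum_(i <- r | A i) a i \o* F i)%R g) =
   \sum_(i <- r | A i) a i * fine (covariance P (F i) g))%R.
Proof.
move=> F2 g2.
pose K f c := f \in Lfun P 2%:E /\ fine (covariance P f g) = c.
apply: (big_ind2 K).
- change (K (cst 0%R) 0%R); split; first exact: Lfun_cst.
  by rewrite covariance_cst_l.
- move=> f c f' c' [f2 <-] [f'2 <-]; split.
    by apply: rpredD => //; rewrite lee1n.
  by rewrite covarianceDl// fineD// fin_num_covariance.
- move=> i Ai; split; first by apply: Lfun_scale; [rewrite ler1n|exact: F2].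
  by rewrite covarianceZl ?Lfun2_mul_Lfun1 ?Lfun2_Lfun1 ?F2// fineM//
    fin_num_covariance// F2.
Qed.

Lemma sum_abs_covariance_le (I : finType) (A : {set I})
    (F : I -> T -> R) g :
  (forall i, i \in A -> F i \in Lfun P 2%:E) -> g \in Lfun P 2%:E ->
  ((\sum_(i in A) `|fine (covariance P (F i) g)|) ^+ 2 <=
   (\sum_(i in A) \sum_(j in A) `|fine (covariance P (F i) (F j))|) *
   fine 'V_P[g])%R.
Proof.
move=> F2 g2.
pose a i := Num.sg (fine (covariance P (F i) g)).
pose Y := (\sum_(i in A) a i \o* F i)%R.
have [Y2 covY] := covariance_suml (index_enum I) a F2 g2.
have V0 f : (0 <= fine 'V_P[f])%R by rewrite fine_ge0 ?variance_ge0.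
have VE f : f \in Lfun P 2%:E -> 'V_P[f] = (fine 'V_P[f])%:E.
  by move=> f2; rewrite fineK// variance_fin_num.
have -> : (\sum_(i in A) `|fine (covariance P (F i) g)| =
    fine (covariance P Y g))%R.
  by rewrite covY; apply: eq_bigr => i _; rewrite /a normrEsg.
(* The variance of [Y] expands bilinearly into covariances weighted by [a i * a j], and these
   weights have absolute value at most 1. *)
have VY : (fine 'V_P[Y] <=
    \sum_(i in A) \sum_(j in A) `|fine (covariance P (F i) (F j))|)%R.
  rewrite /variance [X in (X <= _)%R](covariance_suml _ a F2 Y2).2.
  apply: ler_sum => i iA; rewrite covarianceC.
  rewrite [X in (_ * X <= _)%R](covariance_suml _ a F2 (F2 i iA)).2.
  rewrite mulr_sumr; apply: ler_sum => j jA.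
  rewrite [X in fine X]covarianceC (le_trans (ler_norm _))// !normrM mulrA.
  by rewrite ler_piMl// mulr_ile1// /a normr_sg lern1 leq_b1.
apply: (@le_trans _ _ (fine 'V_P[Y] * fine 'V_P[g])%R); last first.
  by rewrite ler_wpM2r.
have le1 : (fine (covariance P Y g) <=
    Num.sqrt (fine 'V_P[Y]) * Num.sqrt (fine 'V_P[g]))%R.
  rewrite -lee_fin fineK ?fin_num_covariance//.
  by apply: le_trans (covariance_le Y2 g2) _; rewrite (VE Y)// (VE g).
(* Squaring [le1] requires a nonnegative left-hand side. *)
have cov0 : (0 <= fine (covariance P Y g))%R.
  by rewrite covY sumr_ge0// => i _; rewrite /a -normrEsg.
rewrite -[leRHS](sqr_sqrtr (mulr_ge0 (V0 Y) (V0 g))).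
by rewrite lerXn2r ?nnegrE ?sqrtr_ge0// sqrtrM.
Qed.

End covariance.

(** * Exchanging and shrinking finite families *)

(* Quantifying over every [phi] makes the induction go through: indicators
   show that a partner of each new point is still available, and the constant
   [1] gives #|B'| = #|B|. *)
Lemma count_transport (R : numDomainType) (T : finType) (f g : T -> nat)
    (C B : {set T}) :
  (forall k,
     \sum_(x in C) (f x == k)%:R = \sum_(x in C) (g x == k)%:R :> R)%R ->
  B \subset C ->
  exists2 B' : {set T}, B' \subset C &
    forall phi : nat -> R,
      (\sum_(x in B') phi (g x) = \sum_(x in B) phi (f x))%R.
Proof.
move=> fgC; move: {2}#|B| (erefl #|B|) => n; elim: n B => [|n IH] B cB sub.
  exists finset.set0 => [|phi]; first exact: finset.sub0set.
  by rewrite (finset.cards0_eq cB) !big_set0.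
have /card_gt0P[x xB] : (0 < #|B|)%N by rewrite cB.
have xC : x \in C by exact: (fintype.subsetP sub).
have [||B' B'C sumB'] := IH (B :\ x).
- by move: cB; rewrite (finset.cardsD1 x B) xB add1n => -[].
- exact: fintype.subset_trans (finset.subsetDl _ _) sub.
(* Otherwise [B'] contains every point of [C] where [g] equals [f x]. By induction there are as many
   of these as points of [B :\ x] where [f] equals [f x], but [fgC] requires at least one more, for
   [x] itself. *)
have [y] : exists y, [&& y \in C, y \notin B' & g y == f x].
  apply/existsP; apply: contraT => /existsPn noy.
  have: (\sum_(z in C) (g z == f x)%:R = \sum_(z in B') (g z == f x)%:R :> R)%R.
    rewrite (big_setID B') /= (finset.setIidPr B'C).
    rewrite [X in (_ + X)%R]big1 ?addr0//.
    move=> z; rewrite inE => /andP[zB' zC]; move: (noy z).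
    by rewrite zC zB' /= => /negbTE ->.
  rewrite -fgC (sumB' (fun j => (j == f x)%:R%R)) (big_setID B) /=.
  rewrite (finset.setIidPr sub) (big_setD1 x) //= eqxx.
  rewrite addrAC -[RHS]add0r => /addIr/eqP.
  by rewrite paddr_eq0 ?ler01 ?sumr_ge0// oner_eq0.
case/and3P=> yC yB' /eqP gy; exists (y |: B').
  by rewrite finset.subUset finset.sub1set yC.
by move=> phi; rewrite big_setU1//= (big_setD1 x xB)/= gy sumB'.
Qed.

Lemma unif_mean_subset (R : realType) (T : finType) (f : T -> R) (B : {set T})
    (m : nat) :
  (0 < m <= #|B|)%N ->
  exists B' : {set T}, [/\ B' \subset B, #|B'| = m &
    (unif_mean B f <= unif_mean B' f)%R].
Proof.
case/andP=> m0; move: {2}(#|B| - m)%N (erefl (#|B| - m)%N) => k.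
elim: k B => [|k IH] B Bk mB.
  exists B; split=> //; apply/eqP.
  by rewrite eqn_leq mB -subn_eq0 Bk.
have Bm : (m < #|B|)%N by rewrite -subn_gt0 Bk.
have /card_gt0P[x0 x0B] : (0 < #|B|)%N by exact: leq_ltn_trans Bm.
(* Discarding a minimizer of [f] does not decrease the mean. *)
case: (@Order.TotalTheory.arg_minP _ R T x0 (fun x => x \in B) f x0B).
move=> x xB xmin.
have cB : #|B| = #|B :\ x|.+1 by rewrite (finset.cardsD1 x B) xB.
have [||B' [B'B cB' le']] := IH (B :\ x).
- by move: Bk; rewrite cB subSn; [case|rewrite -ltnS -cB].
- by rewrite -ltnS -cB.
exists B'; split => //.
  exact: fintype.subset_trans B'B (finset.subsetDl _ _).
apply: le_trans le'.
have c0 : (0 < #|B :\ x|)%N by rewrite -ltnS -cB; exact: leq_ltn_trans Bm.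
(* Clearing denominators and cancelling leaves [f x * #|B :\ x|] against the sum of [f] over
   [B :\ x]. *)
rewrite /unif_mean cB (big_setD1 x) //=.
rewrite ler_pdivrMr ?ltr0n// mulrAC ler_pdivlMr ?ltr0n//.
rewrite mulrDl -addn1 natrD mulrDr mulr1 addrC lerD2l.
rewrite mulr_natr -sumr_const; apply: ler_sum => y.
by rewrite inE => /andP[_ yB]; exact: xmin.
Qed.

(** * Likelihood ratios as square-integrable densities *)

Section likelihood.
Context (disp : measure_display) (T : measurableType disp) (R : realType).
Context (P0 : probability T R).
Implicit Type Q : probability T R.

Definition density Q (x : T) : R := fine (likelihood_ratio Q P0 x).

Lemma densityE Q x : Q `<< P0 -> (density Q x)%:E = likelihood_ratio Q P0 x.
Proof. by move=> QP; rewrite fineK// Radon_Nikodym_fin_num. Qed.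

Lemma measurable_density Q : Q `<< P0 -> measurable_fun [set: T] (density Q).
Proof.
move=> QP; apply: measurableT_comp => //.
by apply: measurable_int; exact: Radon_Nikodym_integrable.
Qed.

Lemma expectation_density Q (f : T -> R) : Q `<< P0 ->
  Q.-integrable [set: T] (EFin \o f) ->
  'E_P0[(density Q * f)%R] = 'E_Q[f].
Proof.
move=> QP fi; rewrite !unlock -(Radon_Nikodym_change_of_variables QP _ fi)//.
apply: eq_integral => x _.
by rewrite /= mulrC EFinM densityE.
Qed.

Lemma expectation_density1 Q : Q `<< P0 -> 'E_P0[density Q] = 1.
Proof.
move=> QP; rewrite -(mulr1 (density Q)) expectation_density//.
  exact: (expectation_cst Q 1).
exact: (finite_measure_integrable_cst Q 1).
Qed.

(** The finiteness condition is the diagonal case of the second-moment assumption, where the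
    integral equals a real value of [h]. *)
Lemma Lfun2_density Q : Q `<< P0 ->
  \int[P0]_x (likelihood_ratio Q P0 x * likelihood_ratio Q P0 x) < +oo ->
  density Q \in Lfun P0 2%:E.
Proof.
move=> QP Qoo; apply: Lfun2_of_sqr; first exact: measurable_density.
by under eq_integral => x _ do rewrite expr2 EFinM densityE//.
Qed.

Lemma covariance_density Q1 Q2 : Q1 `<< P0 -> Q2 `<< P0 ->
  density Q1 \in Lfun P0 2%:E -> density Q2 \in Lfun P0 2%:E ->
  covariance P0 (density Q1) (density Q2) =
  \int[P0]_x (likelihood_ratio Q1 P0 x * likelihood_ratio Q2 P0 x) - 1.
Proof.
move=> QP1 QP2 l1 l2.
rewrite covarianceE ?Lfun2_mul_Lfun1 ?Lfun2_Lfun1//.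
rewrite !expectation_density1// mule1.
rewrite unlock; congr (_ - _); apply: eq_integral => x _.
by rewrite EFinM !densityE.
Qed.

Lemma covariance_density_query Q (f : T -> R) b : Q `<< P0 ->
  density Q \in Lfun P0 2%:E -> measurable_fun [set: T] f ->
  (forall x, `|f x| <= b)%R ->
  covariance P0 (density Q) f = 'E_Q[f] - 'E_P0[f].
Proof.
move=> QP l mf fb; have f2 := Lfun2_bounded P0 mf fb.
rewrite covarianceE ?Lfun2_mul_Lfun1 ?Lfun2_Lfun1//.
rewrite expectation_density1// mul1e expectation_density//.
apply/Lfun1_integrable/Lfun2_Lfun1.
exact: (Lfun2_bounded Q mf fb).
Qed.

End likelihood.

(** * Averaging and the best mean overlap *)

Lemma exists_ge_mean (R : realType) (T : finType) (A : {set T})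
    (f : T -> R) (c : R) :
  A != finset.set0 -> (#|A|%:R * c <= \sum_(x in A) f x)%R ->
  exists2 x, x \in A & (c <= f x)%R.
Proof.
move=> A0 le_sum; apply/exists_inP; apply: contraTT le_sum.
move=> /exists_inPn fc; rewrite -ltNge mulr_natl -sumr_const.
have /finset.set0Pn[x xA] := A0.
apply: ltr_sum => [|y yA]; last by rewrite ltNge fc.
by apply/hasP; exists x => //; exact: mem_index_enum.
Qed.

(** Equal overlap laws over [C] mean that each overlap size is attained equally often with [S1] and
    with [S2]. [count_transport] then applies, with [phi] equal to [h] for the sums and to the
    constant 1 for the cardinalities. *)
Lemma overlap_exchange (R : realType) (d : nat) (C B : {set {set 'I_d}})
    (h : nat -> R) (S1 S2 : {set 'I_d}) :
  S1 \in C ->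
  (forall k, overlap_pmf R C S1 k = overlap_pmf R C S2 k) -> B \subset C ->
  exists B' : {set {set 'I_d}}, [/\ B' \subset C, #|B'| = #|B| &
    mean_overlap h B' S2 = mean_overlap h B S1].
Proof.
move=> S1C pmfE BC.
have C0 : (#|C|%:R != 0 :> R)%R.
  by rewrite pnatr_eq0 -lt0n; apply/card_gt0P; exists S1.
have cntE k : (\sum_(S in C) (#|S1 :&: S| == k)%:R =
    \sum_(S in C) (#|S2 :&: S| == k)%:R :> R)%R.
  exact: (divIf C0 (pmfE k)).
have [B' B'C sumE] := count_transport cntE BC.
have cB : #|B'| = #|B|.
  have /eqP := sumE (fun=> 1%R); rewrite !sumr_const eqr_nat.
  by move/eqP.
by exists B'; split => //; rewrite /mean_overlap /unif_mean sumE cB.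
Qed.

(** This involves neither [q] nor a choice of maximizers, so it can serve as the function of [#|Cq|]
    in the theorem. *)
Definition best_mean_overlap (R : realType) (d : nat) (h : nat -> R)
    (C : {set {set 'I_d}}) (m : nat) : \bar R :=
  ereal_sup [set x | exists S (B : {set {set 'I_d}}),
    [/\ S \in C, B \subset C, #|B| = m & x = (mean_overlap h B S)%:E]].

(** Each competitor of size [m2] shrinks to one of size [m1] at the same [S]. Positivity of [m1]
    excludes the empty family, whose mean has the default value 0. *)
Lemma best_mean_overlap_nonincr (R : realType) (d : nat) (h : nat -> R)
    (C : {set {set 'I_d}}) (m1 m2 : nat) :
  (0 < m1)%N -> (m1 <= m2)%N ->
  best_mean_overlap h C m2 <= best_mean_overlap h C m1.
Proof.
move=> m1_gt0 m12; apply: ge_ereal_sup => _ [S [B [SC BC cB ->]]].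
have [|B' [B'B cB' le']] :=
  @unif_mean_subset _ _ (fun S' => h #|S :&: S'|) B m1.
  by rewrite m1_gt0 cB.
apply: (@le_trans _ _ (mean_overlap h B' S)%:E); first by rewrite lee_fin.
apply: ereal_sup_ubound; exists S, B'; split => //.
exact: fintype.subset_trans B'B BC.
Qed.

Lemma sup_mean_overlapE (R : realType) (d : nat) (h : nat -> R)
    (C D : {set {set 'I_d}}) (Cbar : {set 'I_d} -> {set {set 'I_d}}) :
  (forall S1 S2, S1 \in C -> S2 \in C ->
     forall k, overlap_pmf R C S1 k = overlap_pmf R C S2 k) ->
  D \subset C -> D != finset.set0 ->
  (forall S, S \in D -> is_max_subfamily h C #|D| S (Cbar S)) ->
  sup_mean_overlap h D Cbar = best_mean_overlap h C #|D|.
Proof.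
move=> pmfE DC /finset.set0Pn[S0 S0D] maxC; apply/eqP; rewrite eq_le.
have inC := fintype.subsetP DC.
apply/andP; split; apply: ge_ereal_sup => z.
  move=> [S SD <-]; apply: ereal_sup_ubound; exists S, (Cbar S).
  by have [? ? _] := maxC _ SD; split => //; exact: inC.
move=> [S [B [SC BC cB ->]]] {z}.
(* Every competing pair moves to the fixed [S0] in [D], where [Cbar S0] does at least as well. *)
have [B' [B'C cB' <-]] := overlap_exchange h SC (pmfE S S0 SC (inC _ S0D)) BC.
have [_ _ max0] := maxC _ S0D.
apply: (@le_trans _ _ (mean_overlap h (Cbar S0) S0)%:E).
  by rewrite lee_fin max0// cB'.
by apply: ereal_sup_ubound; exists S0.
Qed.

(** * The lower bound over the distinguished family *)

Lemma distinguished_xi0 (R : realType) (disp : measure_display)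
    (X : measurableType disp) (d : nat) (C : {set {set 'I_d}})
    (P0 : probability X R) (P : {set 'I_d} -> probability X R)
    (b : R) (n : nat) (q : X -> R) :
  (0 < b)%R -> (0 < n)%N -> distinguished C P0 P b n 0 q = finset.set0.
Proof.
move=> b0 n0; apply/finset.setP => S; rewrite !inE; apply/negbTE.
rewrite negb_and -leNgt; apply/orP; right.
(* The first entry of the maximum is [+oo]. The second would not do: for zero variance it is
   [0 * +oo = 0]. *)
rewrite /tau_bar /log_inv inve0 /= inver pnatr_eq0 gtn_eqF// mulyr.
rewrite gtr0_sg ?invr_gt0 ?ltr0n// mul1e mulry gtr0_sg ?divr_gt0 ?mulr_gt0//.
by rewrite mul1e le_max leey.
Qed.

Lemma log_invE (R : realType) (xi : R) :
  (0 < xi)%R -> log_inv xi = (ln xi^-1)%:E.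
Proof. by move=> x0; rewrite /log_inv inver gt_eqF// lne_EFin// invr_gt0. Qed.

Lemma distinguished_mean_overlap (R : realType) (d : nat)
    (C : {set {set 'I_d}}) (disp : measure_display) (X : measurableType disp)
    (P0 : probability X R) (P : {set 'I_d} -> probability X R) (h : nat -> R)
    (b : R) (n : nat) (xi : R) (q : X -> R)
    (Cq := distinguished C P0 P b n xi q) :
  (0 < n)%N -> (0 < xi)%R -> (xi <= 1)%R ->
  (forall S, S \in C -> P S `<< P0) ->
  (forall i, (1 <= h i)%R) ->
  (forall S1 S2, S1 \in C -> S2 \in C ->
     \int[P0]_x (likelihood_ratio (P S1) P0 x * likelihood_ratio (P S2) P0 x)
     = (h #|S1 :&: S2|)%:E) ->
  query_function b q -> Cq != finset.set0 ->
  exists2 S, S \in Cq & 1 + log_inv xi / n%:R%:E <= (mean_overlap h Cq S)%:E.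
Proof.
move=> n_gt0 xi_gt0 xi_le1 P_dom h_ge1 chi2_overlap [mq bq] Cq0.
have dens2 S : S \in C -> density P0 (P S) \in Lfun P0 2%:E.
  move=> SC; apply: Lfun2_density; first exact: P_dom.
  by rewrite chi2_overlap ?ltry.
have CqC : {subset Cq <= C} by move=> S; rewrite inE => /andP[].
have qb x : (`|q x| <= b)%R by rewrite ler_norml.
have q2 := Lfun2_bounded P0 mq qb.
pose c S := fine (covariance P0 (density P0 (P S)) q).
pose v := fine 'V_P0[q].
pose L := (ln xi^-1 / n%:R)%R.
have logE : log_inv xi / n%:R%:E = L%:E.
  by rewrite log_invE// inver pnatr_eq0 gtn_eqF.
have L0 : (0 <= L)%R by rewrite divr_ge0// ln_ge0// invf_ge1.
have v0 : (0 <= v)%R by rewrite fine_ge0// variance_ge0.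
(* Only the variance entry of the maximum in [tau_bar] is kept. *)
have c_gt S : S \in Cq -> (Num.sqrt (2 * v * L) < `|c S|)%R.
  move=> SCq; have SC := CqC _ SCq; move: (SCq); rewrite inE => /andP[_].
  rewrite -(covariance_density_query (P_dom _ SC) (dens2 _ SC) mq qb).
  rewrite -[covariance _ _ _]fineK ?fin_num_covariance ?dens2//.
  rewrite /tau_bar gt_max => /andP[_].
  by rewrite -muleA logE -[X in 2%:E * X]fineK ?variance_fin_num//.
pose m : R := #|Cq|%:R.
have m_gt0 : (0 < m)%R by rewrite ltr0n card_gt0.
pose H := (\sum_(S in Cq) \sum_(S' in Cq) (h #|S :&: S'| - 1))%R.
have sum_le : ((\sum_(S in Cq) `|c S|) ^+ 2 <= H * v)%R.
  apply: le_trans (sum_abs_covariance_le _ q2) _.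
    by move=> S /CqC; exact: dens2.
  rewrite ler_wpM2r//; apply: ler_sum => S /CqC SC.
  apply: ler_sum => S' /CqC SC'.
  rewrite covariance_density ?dens2 ?chi2_overlap//; try exact: P_dom.
  by rewrite /= ger0_norm// subr_ge0.
have lt_sum : (m * Num.sqrt (2 * v * L) < \sum_(S in Cq) `|c S|)%R.
  rewrite /m mulr_natl -sumr_const; have /finset.set0Pn[S SCq] := Cq0.
  apply: ltr_sum => //.
  by apply/hasP; exists S => //; exact: mem_index_enum.
have lt_H : (m ^+ 2 * (2 * L) * v < H * v)%R.
  apply: lt_le_trans sum_le.
  have -> : (m ^+ 2 * (2 * L) * v = (m * Num.sqrt (2 * v * L)) ^+ 2)%R.
    by rewrite exprMn sqr_sqrtr; [ring|exact: mulr_ge0 (mulr_ge0 _ v0) L0].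
  rewrite ltr_pXn2r// nnegrE ?sumr_ge0//.
  exact: mulr_ge0 (ltW m_gt0) (sqrtr_ge0 _).
(* For [v = 0] both sides of the strict inequality [lt_H] would vanish, so [v] can be cancelled. *)
have v_gt0 : (0 < v)%R.
  rewrite lt_neqAle v0 andbT; apply: contraTneq lt_H => <-.
  by rewrite !mulr0 ltxx.
rewrite ltr_pM2r// in lt_H.
(* The [m] row sums add up to [H], which exceeds [m ^+ 2 * (2 * L)] and hence [m * (m * L)], so some
   row sum is at least [m * L]. *)
have [|S SCq le_S] := @exists_ge_mean R _ Cq
    (fun S => \sum_(S' in Cq) (h #|S :&: S'| - 1))%R (m * L)%R Cq0.
  apply: le_trans (ltW lt_H); rewrite -/m mulrA -expr2 ler_wpM2l ?sqr_ge0//.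
  by rewrite ler_peMl// ler1n.
exists S => //; rewrite logE -EFinD lee_fin /mean_overlap /unif_mean -/m.
rewrite ler_pdivlMr// mulrC mulrDr mulr1 -lerBrDl.
by apply: le_trans le_S _; rewrite sumrB sumr_const.
Qed.

Theorem theorem4p4 (R : realType) (d : nat) (C : {set {set 'I_d}})
    (disp : measure_display) (X : measurableType disp)
    (P0 : probability X R) (P : {set 'I_d} -> probability X R)
    (h : nat -> R) (b : R) (n : nat) (xi : R)
    (b_gt0 : (0 < b)%R) (n_gt0 : (0 < n)%N) (xi_ge0 : (0 <= xi)%R)
    (xi_lt : (xi < 1 / 4)%R)
    (P_dom : forall S, S \in C -> P S `<< P0)
    (overlap_same : forall S1 S2, S1 \in C -> S2 \in C ->
       forall k, overlap_pmf R C S1 k = overlap_pmf R C S2 k)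
    (h_nondecr : forall i j : nat, (i <= j)%N -> (h i <= h j)%R)
    (h0_ge1 : (1 <= h 0%N)%R)
    (chi2_overlap : forall S1 S2, S1 \in C -> S2 \in C ->
       \int[P0]_x (likelihood_ratio (P S1) P0 x * likelihood_ratio (P S2) P0 x)
       = (h #|S1 :&: S2|)%:E) :
  (forall (q : X -> R) (Cbar : {set 'I_d} -> {set {set 'I_d}}),
     let Cq := distinguished C P0 P b n xi q in
     query_function b q -> Cq != finset.set0 ->
     (forall S, S \in Cq -> is_max_subfamily h C #|Cq| S (Cbar S)) ->
     1 + log_inv xi / n%:R%:E <= sup_mean_overlap h Cq Cbar)
  /\
  (exists F : nat -> \bar R,
     (forall m1 m2 : nat, (0 < m1)%N -> (m1 <= m2)%N -> (m2 <= #|C|)%N ->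
        F m2 <= F m1) /\
     (forall (q : X -> R) (Cbar : {set 'I_d} -> {set {set 'I_d}}),
        let Cq := distinguished C P0 P b n xi q in
        query_function b q -> Cq != finset.set0 ->
        (forall S, S \in Cq -> is_max_subfamily h C #|Cq| S (Cbar S)) ->
        sup_mean_overlap h Cq Cbar = F #|Cq|)).
Proof.
have h_ge1 i : (1 <= h i)%R by exact: le_trans h0_ge1 (h_nondecr _ _ (leq0n i)).
have CqC q : distinguished C P0 P b n xi q \subset C.
  by apply/fintype.subsetP => S; rewrite inE => /andP[].
split=> [q Cbar Cq q_query Cq0 Cbar_max|].
  have xi_gt0 : (0 < xi)%R.
    rewrite lt_neqAle xi_ge0 andbT; apply: contraNneq Cq0 => xi0.
    by rewrite /Cq -xi0 distinguished_xi0.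
  have xi_le1 : (xi <= 1)%R by lra.
  have [S SCq le_S] := distinguished_mean_overlap n_gt0 xi_gt0 xi_le1
    P_dom h_ge1 chi2_overlap q_query Cq0.
  apply: le_trans le_S _.
  (* [Cq] is itself a competitor in the maximization defining [Cbar S]. *)
  apply: (@le_trans _ _ (mean_overlap h (Cbar S) S)%:E).
    by have [_ _ max_S] := Cbar_max _ SCq; rewrite lee_fin max_S.
  by apply: ereal_sup_ubound; exists S.
exists (best_mean_overlap h C).
split=> [m1 m2 m1_gt0 m12 _|q Cbar Cq _ Cq0 maxC].
  exact: best_mean_overlap_nonincr.
exact: sup_mean_overlapE overlap_same (CqC q) Cq0 maxC.
Qed.
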